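(* Let $\mathcal{A}$ be an essentially small abelian category. Assume that $\mathcal{A}$ admits a generator $M$ such that the endomorphism ring $\mathrm{End}_{\mathcal{A}}(M)$ is right artinian. Then each of the categories $\mathrm{fl}(\mathcal{A})$ and $\mathcal{A}$ has a projective generator which is a direct summand of $M$.
   Context: An object $M$ of an abelian category $\mathcal{A}$ is a generator of $\mathcal{A}$ if for every object $X$ of $\mathcal{A}$ there is an index set $I$ (for which the coproduct $\bigoplus_{i\in I} M$ exists in $\mathcal{A}$) and an epimorphism $\bigoplus_{i\in I} M \to X$. A projective generator is a generator that is a projective object. An object is artinian (resp. noetherian) if every descending (resp. ascending) chain of its subobjects becomes stationary; it has finite length if it is both artinian and noetherian. $\mathrm{fl}(\mathcal{A})$ denotes the full subcategory of $\mathcal{A}$ of objects of finite length, which is an abelian category closed under kernels, cokernels and extensions in $\mathcal{A}$; ''projective generator of $\mathrm{fl}(\mathcal{A})$'' is understood inside this abelian category. *)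

(* Defs.v *)
From HB Require Import structures.
From mathcomp Require Import all_boot all_algebra.
From mathcomp Require Import boolp classical_sets.

Set Implicit Arguments.
Unset Strict Implicit.
Unset Printing Implicit Defensive.

Import GRing.Theory.
Local Open Scope ring_scope.

(* Small sets are the types in the universe of carriers of zmodTypes, which is
   where hom-groups live: all categories below are locally small, and their
   collection of objects may be large. *)
Definition smallType := Type@{Algebra.Zmodule.axioms_.u0}.

Record preadditive := Preadditive {
  obj :> Type;
  hom : obj -> obj -> zmodType;
  idm : forall X, hom X X;
  hcomp : forall X Y Z, hom Y Z -> hom X Y -> hom X Z;
  hcomp_idl : forall X Y (f : hom X Y), hcomp (idm Y) f = f;
  hcomp_idr : forall X Y (f : hom X Y), hcomp f (idm X) = f;
  hcompA : forall W X Y Z (h : hom Y Z) (g : hom X Y) (f : hom W X),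
    hcomp h (hcomp g f) = hcomp (hcomp h g) f;
  hcompDl : forall X Y Z (g1 g2 : hom Y Z) (f : hom X Y),
    hcomp (g1 + g2) f = hcomp g1 f + hcomp g2 f;
  hcompDr : forall X Y Z (g : hom Y Z) (f1 f2 : hom X Y),
    hcomp g (f1 + f2) = hcomp g f1 + hcomp g f2
}.

Arguments hom {_} _ _.
Arguments idm {_} _.
Arguments hcomp {_ _ _ _} _ _.

Notation "g \oc f" := (hcomp g f) (at level 40, left associativity).

Section Notions.
Variable C : preadditive.
Implicit Types W X Y Z M P Q : C.

Definition monomorphism X Y (f : hom X Y) : Prop :=
  forall W (u v : hom W X), f \oc u = f \oc v -> u = v.

Definition epimorphism X Y (f : hom X Y) : Prop :=
  forall Z (u v : hom Y Z), u \oc f = v \oc f -> u = v.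

Definition isomorphic X Y : Prop :=
  exists (f : hom X Y) (g : hom Y X), g \oc f = idm X /\ f \oc g = idm Y.

Definition is_zero_object Z : Prop :=
  forall X, (exists! f : hom X Z, True) /\ (exists! f : hom Z X, True).

Definition is_biproduct X1 X2 Y (i1 : hom X1 Y) (i2 : hom X2 Y)
    (p1 : hom Y X1) (p2 : hom Y X2) : Prop :=
  [/\ p1 \oc i1 = idm X1, p2 \oc i2 = idm X2, p1 \oc i2 = 0, p2 \oc i1 = 0
    & i1 \oc p1 + i2 \oc p2 = idm Y].

Definition is_kernel K X Y (k : hom K X) (f : hom X Y) : Prop :=
  f \oc k = 0 /\
  forall W (t : hom W X), f \oc t = 0 -> exists! u : hom W K, k \oc u = t.

Definition is_cokernel X Y Q (q : hom Y Q) (f : hom X Y) : Prop :=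
  q \oc f = 0 /\
  forall W (t : hom Y W), t \oc f = 0 -> exists! u : hom Q W, u \oc q = t.

Record is_abelian : Prop := IsAbelian {
  ab_zero : exists Z, is_zero_object Z;
  ab_biproduct : forall X1 X2, exists Y (i1 : hom X1 Y) (i2 : hom X2 Y)
    (p1 : hom Y X1) (p2 : hom Y X2), is_biproduct i1 i2 p1 p2;
  ab_kernel : forall X Y (f : hom X Y),
    exists K (k : hom K X), is_kernel k f;
  ab_cokernel : forall X Y (f : hom X Y),
    exists Q (q : hom Y Q), is_cokernel q f;
  ab_monic_normal : forall X Y (f : hom X Y), monomorphism f ->
    exists Z (g : hom Y Z), is_kernel f g;
  ab_epic_normal : forall X Y (f : hom X Y), epimorphism f ->
    exists W (g : hom W X), is_cokernel f g
}.

Definition essentially_small : Prop :=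
  exists (S : smallType) (F : S -> C), forall X, exists s, isomorphic (F s) X.

Definition is_coproduct (I : smallType) (F : I -> C) Y
    (inj : forall i, hom (F i) Y) : Prop :=
  forall W (t : forall i, hom (F i) W),
    exists! u : hom Y W, forall i, u \oc inj i = t i.

Definition generator M : Prop :=
  forall X, exists (I : smallType) (S : C) (inj : I -> hom M S) (e : hom S X),
    is_coproduct (F := fun=> M) inj /\ epimorphism e.

Definition projective P : Prop :=
  forall X Y (e : hom X Y), epimorphism e ->
  forall f : hom P Y, exists g : hom P X, e \oc g = f.

Definition projective_generator P : Prop := generator P /\ projective P.

Definition direct_summand P M : Prop :=
  exists Q (i1 : hom P M) (i2 : hom Q M) (p1 : hom M P) (p2 : hom M Q),
    is_biproduct i1 i2 p1 p2.

Record subobject X := Subobject {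
  sub_dom : C;
  sub_mor : hom sub_dom X;
  sub_monic : monomorphism sub_mor
}.

Definition sub_le X (U V : subobject X) : Prop :=
  exists t : hom (sub_dom U) (sub_dom V), sub_mor V \oc t = sub_mor U.

Definition sub_eq X (U V : subobject X) : Prop := sub_le U V /\ sub_le V U.

Definition artinian X : Prop :=
  forall U : nat -> subobject X, (forall n, sub_le (U n.+1) (U n)) ->
  exists N, forall n, (N <= n)%N -> sub_eq (U n) (U N).

Definition noetherian X : Prop :=
  forall U : nat -> subobject X, (forall n, sub_le (U n) (U n.+1)) ->
  exists N, forall n, (N <= n)%N -> sub_eq (U n) (U N).

Definition finite_length X : Prop := artinian X /\ noetherian X.

End Notions.

Section FullSubcategory.
Variables (C : preadditive) (D : C -> Prop).
Implicit Types W X Y Z : {X : C | D X}.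

Definition full_subcategory : preadditive :=
  @Preadditive {X : C | D X} (fun X Y => hom (sval X) (sval Y))
    (fun X => idm (sval X)) (fun X Y Z g f => g \oc f)
    (fun X Y f => hcomp_idl f) (fun X Y f => hcomp_idr f)
    (fun W X Y Z h g f => hcompA h g f)
    (fun X Y Z g1 g2 f => hcompDl g1 g2 f)
    (fun X Y Z g f1 f2 => hcompDr g f1 f2).

End FullSubcategory.

Definition fl (C : preadditive) : preadditive :=
  full_subcategory (@finite_length C).

Definition fl_incl (C : preadditive) (X : fl C) : C := sval X.

(* The product of the endomorphism ring is composition, f * g = f \oc g; this
   is what distinguishes right ideals from left ideals. *)
Definition End_ring (C : preadditive) (M : C) : Type := hom M M.

HB.instance Definition _ (C : preadditive) (M : C) :=
  GRing.Zmodule.on (End_ring M).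

HB.instance Definition _ (C : preadditive) (M : C) :=
  GRing.Zmodule_isPzRing.Build (End_ring M)
    (fun f g h : hom M M => hcompA f g h)
    (fun f : hom M M => hcomp_idl f) (fun f : hom M M => hcomp_idr f)
    (fun f g h : hom M M => hcompDl f g h)
    (fun f g h : hom M M => hcompDr f g h).

Section RightArtinian.
Variable R : pzRingType.
Local Open Scope classical_set_scope.

Definition right_ideal (J : set R) : Prop :=
  [/\ J 0, forall x y, J x -> J y -> J (x - y)
    & forall x a, J x -> J (x * a)].

Definition right_artinian : Prop :=
  forall J : nat -> set R, (forall n, right_ideal (J n)) ->
  (forall n, J n.+1 `<=` J n) ->
  exists N, forall n, (N <= n)%N -> J n = J N.

End RightArtinian.

Lemma End_ring_mulE (C : preadditive) (M : C) (f g : End_ring M) :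
  f * g = (f : hom M M) \oc (g : hom M M).
Proof. by []. Qed.

(* Main.v *)
From mathcomp Require Import all_boot all_algebra.
From mathcomp Require Import boolp classical_sets.
Require Import Defs.

(** Let [E] be the endomorphism ring of [M].  The right [E]-module [Hom(M, X)]
    remembers [X], because [M] is a generator; the proof moves between objects
    and right ideals of [E] through this functor.

    Call a right ideal of [E] dense if its elements are jointly epi on [M].
    Since [E] is right artinian there is a minimal dense right ideal [I].  As
    epimorphisms are stable under pullback and [M] is a generator, the maps
    [M -> M] along which a given [g : M -> Y] lifts through an epimorphism
    [X -> Y] are jointly epi; by minimality, [g x] lifts for every [x] in [I]
    ([minimal_dense_ideal_lift]).  Hence [P = e M] is projective for each
    idempotent [e] of [I].

    Any right ideal of a right artinian ring is [e E + N] with [e] idempotent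
    and [N] nilpotent ([right_ideal_idempotent], which rests on Brauer's lemma
    [idempotent_of_nonnilpotent]).  For this [e] in [I], powers of [I] are dense
    and lie in [E e E + N^k], where [N^k = 0] for large [k]; so [E e E] is
    dense, that is, the maps from [P] to [M] are jointly epi
    ([dense_ideal_idempotent]).

    By Hopkins' theorem ([right_artinian_noetherian]), [E] is right noetherian
    too, so [M] and finite sums of retracts of [M] have finite length.
    Therefore finitely many maps [P -> M] are already jointly epi, which makes
    [P] a generator, and any object of finite length is a quotient of a finite
    sum of copies of [P], which makes [P] a generator of the category of objects
    of finite length.  There [P] is also projective, because the epimorphisms
    of that category are epimorphisms of the whole category. *)

Set Implicit Arguments.
Unset Strict Implicit.
Unset Printing Implicit Defensive.

Import GRing.Theory.

Lemma subrACA (V : zmodType) (x y z t : V) :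
  (x - y - (z - t) = (x - z) - (y - t))%R.
Proof. by rewrite !opprB [(t - z)%R]addrC addrACA [(- y + t)%R]addrC. Qed.

(** * Right ideals of right artinian rings *)

Section RightIdeals.
Local Open Scope ring_scope.
Local Open Scope classical_set_scope.
Variable R : pzRingType.
Implicit Types (I J K N U V : set R) (x y e : R).

Lemma right_ideal0 J : right_ideal J -> J 0.
Proof. by case. Qed.

Lemma right_idealB J x y : right_ideal J -> J x -> J y -> J (x - y).
Proof. by case=> _ + _; apply. Qed.

Lemma right_idealM J x y : right_ideal J -> J x -> J (x * y).
Proof. by case=> _ _; apply. Qed.

Lemma right_idealN J x : right_ideal J -> J x -> J (- x).
Proof.
by move=> idJ Jx; rewrite -sub0r; apply: right_idealB => //; apply: right_ideal0.
Qed.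

Lemma right_idealD J x y : right_ideal J -> J x -> J y -> J (x + y).
Proof.
move=> idJ Jx Jy; rewrite -[y]opprK.
by apply: right_idealB => //; apply: right_idealN.
Qed.

Lemma right_ideal_setT : right_ideal [set: R].
Proof. by []. Qed.

Lemma right_idealI J K : right_ideal J -> right_ideal K -> right_ideal (J `&` K).
Proof.
move=> idJ idK; split=> [|x y [Jx Kx] [Jy Ky]|x a [Jx Kx]].
- by split; apply: right_ideal0.
- by split; apply: right_idealB.
- by split; apply: right_idealM.
Qed.

Lemma right_ideal_rann J x : right_ideal J ->
  right_ideal [set y | J y /\ x * y = 0].
Proof.
move=> idJ; split=> [|y z [Jy xy] [Jz xz]|y a [Jy xy]] /=.
- by rewrite mulr0; split=> //; apply: right_ideal0.
- by rewrite mulrBr xy xz subr0; split=> //; apply: right_idealB.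
- by rewrite mulrA xy mul0r; split=> //; apply: right_idealM.
Qed.

Lemma right_ideal_lmul J x : right_ideal J ->
  right_ideal [set x * y | y in J].
Proof.
move=> idJ; split=> [|_ _ [y Jy <-] [z Jz <-]|_ a [y Jy <-]] /=.
- by exists 0; [apply: right_ideal0 | rewrite mulr0].
- by exists (y - z); [apply: right_idealB | rewrite mulrBr].
- by exists (y * a); [apply: right_idealM | rewrite mulrA].
Qed.

Definition right_ideal_square U : set R :=
  [set x | forall K, right_ideal K ->
     (forall a b, U a -> U b -> K (a * b)) -> K x].

Lemma right_ideal_square_ideal U : right_ideal (right_ideal_square U).
Proof.
split=> [K idK _|x y Ux Uy K idK UK|x a Ux K idK UK].
- exact: right_ideal0.
- by apply: right_idealB; [|apply: Ux|apply: Uy].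
- by apply: right_idealM; [|apply: Ux].
Qed.

Lemma right_ideal_square_sub U : right_ideal U -> right_ideal_square U `<=` U.
Proof.
by move=> idU x; apply=> // a b Ua _; apply: right_idealM.
Qed.

(** Powers of [N] enter through their action on the right, as [x N^k = 0], which
    avoids additive spans of products. *)
Fixpoint annihilated N k x : Prop :=
  if k is k'.+1 then forall a, N a -> annihilated N k' (x * a) else x = 0.

Definition nilpotent_ideal N : Prop := exists k, annihilated N k 1.

Lemma annihilated_mul N k x y : annihilated N k x -> annihilated N k (y * x).
Proof.
elim: k x => [|k IHk] x /=; first by move=> ->; rewrite mulr0.
by move=> xN a Na; rewrite -mulrA; apply/IHk/xN.
Qed.

Lemma nilpotent_ideal_exp N y :
  nilpotent_ideal N -> N y -> exists k, y ^+ k.+1 = 0.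
Proof.
move=> [k N0] Ny; exists k; move: N0.
have: forall x, annihilated N k x -> x * y ^+ k = 0.
  elim: k => [|j IHj] x /=; first by rewrite mulr1.
  by move=> /(_ y Ny) /IHj; rewrite exprS mulrA.
by move=> /[apply]; rewrite mul1r exprSr => ->; rewrite mul0r.
Qed.

Lemma nilpotent_ideal_square U :
  nilpotent_ideal (right_ideal_square U) -> nilpotent_ideal U.
Proof.
move=> [k U0]; exists k.*2; move: U0; elim: k 1 => [//|k IHk] x xU a Ua b Ub.
rewrite -mulrA; apply/IHk/xU => K idK; exact.
Qed.

(** If [x^k (1 - x)^k = 0], then [x^k = x^{k+1} q] with [q] the geometric sum
    [1 + (1 - x) + ... + (1 - x)^{k-1}], and [x^k q^k] is idempotent. *)
Lemma idempotent_lift x k : (x * x - x) ^+ k = 0 ->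
  exists q, let f := x ^+ k * q in f * f = f /\ x ^+ k * f = x ^+ k.
Proof.
move=> xk0.
have cx1 : GRing.comm x (1 - x) by rewrite /GRing.comm mulrBr mulrBl mulr1 mul1r.
have xk0' : x ^+ k * (1 - x) ^+ k = 0.
  by rewrite -exprMn_comm // mulrBr mulr1 -opprB exprNn xk0 mulr0.
pose q := \sum_(i < k) (1 - x) ^+ i.
have xq : 1 - (1 - x) ^+ k = x * q.
  rewrite -opprB subrX1 -mulNr; congr (_ * _).
  by rewrite opprB opprB addrC subrK.
have cxq : GRing.comm x q.
  by apply: commr_sum => i _; apply: commrX.
have step : x ^+ k = x ^+ k * (x * q).
  by rewrite -xq mulrBr mulr1 xk0' subr0.
have steps n : x ^+ k = x ^+ k * (x ^+ n * q ^+ n).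
  rewrite -exprMn_comm //; elim: n => [|n IHn]; first by rewrite mulr1.
  by rewrite exprS mulrA -step.
exists (q ^+ k); split; last by rewrite -steps.
rewrite -mulrA [q ^+ k * _]mulrA.
have -> : q ^+ k * x ^+ k = x ^+ k * q ^+ k.
  by apply/commrX/commr_sym/commrX.
by rewrite !mulrA -[x ^+ k * x ^+ k * q ^+ k]mulrA -steps.
Qed.

Hypothesis artR : right_artinian R.

Lemma minimal_right_ideal (P : set R -> Prop) J0 :
  right_ideal J0 -> P J0 ->
  exists J, [/\ right_ideal J, P J &
    forall K, right_ideal K -> P K -> K `<=` J -> J `<=` K].
Proof.
move=> idJ0 PJ0; apply: contrapT => noMin.
pose T := {J | right_ideal J /\ P J}.
have smaller (J : T) : exists K : T, sval K `<=` sval J /\ ~ (sval J `<=` sval K).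
  apply: contrapT => noK; apply: noMin; exists (sval J).
  case: J noK => J [idJ PJ] /= noK; split=> // K idK PK KJ.
  apply: contrapT => nJK; apply: noK.
  by exists (exist _ K (conj idK PK)).
have [f fP] := choice smaller.
pose U n := iter n f (exist _ J0 (conj idJ0 PJ0) : T).
have [n|n|N stat] := artR (J := fun n => sval (U n)).
- by case: (U n) => J [].
- exact: (fP (U n)).1.
- by have [_] := fP (U N); apply; rewrite -(stat N.+1).
Qed.

(** Brauer: let [U] be minimal among the non-nilpotent right ideals inside [I],
    so that [U^2 = U], and let [V] inside [U] be minimal with [V U <> 0].  Any
    [v] in [V] with [v U <> 0] then satisfies [v U = V], whence [v = v x] with
    [x] in [U].  The right ideal of all [y] in [U] with [v y = 0] is smaller
    than [U], hence nilpotent, and contains [x^2 - x]: thus [x] can be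
    corrected to an idempotent. *)
Lemma idempotent_of_nonnilpotent I : right_ideal I -> ~ nilpotent_ideal I ->
  exists e, [/\ I e, e * e = e & e <> 0].
Proof.
move=> idI nnI.
have [|U [idU [UI nnU] minU]] :=
  minimal_right_ideal (P := fun U => U `<=` I /\ ~ nilpotent_ideal U) idI.
  by split.
have U2 : U `<=` right_ideal_square U.
  apply: minU (right_ideal_square_sub idU); first exact: right_ideal_square_ideal.
  split; last by move/nilpotent_ideal_square.
  exact: subset_trans (right_ideal_square_sub idU) UI.
pose meetsU V := V `<=` U /\ exists v w, [/\ V v, U w & v * w <> 0].
have meetsUU : meetsU U.
  split=> //; apply: contrapT => UU0; apply: nnU; exists 2%N => a Ua b Ub /=.
  by rewrite mul1r; apply: contrapT => ab; apply: UU0; exists a, b.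
have [V [idV [VU [v [w [Vv Uw vw]]]] minV]] := minimal_right_ideal idU meetsUU.
have vU2 : exists a b, [/\ U a, U b & v * a * b <> 0].
  apply: contrapT => vUU0; apply: vw.
  apply: (U2 _ Uw [set y | setT y /\ v * y = 0] _ _).2.
    exact: right_ideal_rann.
  move=> a b Ua Ub; split=> //; rewrite mulrA; apply: contrapT => vab.
  by apply: vUU0; exists a, b.
have [x Ux vx] : [set v * y | y in U] v.
  apply: (minV _ (right_ideal_lmul v idU)) => //.
    split=> [_ [y Uy <-]|]; first by apply: right_idealM => //; apply: VU.
    have [a [b [Ua Ub vab]]] := vU2.
    by exists (v * a), b; split=> //; exists a.
  by move=> _ [y Uy <-]; apply: right_idealM.
have nilW : nilpotent_ideal [set y | U y /\ v * y = 0].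
  apply: contrapT => nnW; apply: vw.
  apply: (minU _ (right_ideal_rann v idU) _ _ w Uw).2 => [|y []//].
  by split=> // y [/UI].
have [k xk0] : exists k, (x * x - x) ^+ k.+1 = 0.
  apply: nilpotent_ideal_exp nilW _; split.
    by apply: right_idealB => //; apply: right_idealM.
  by rewrite mulrBr mulrA !vx subrr.
have [q [ide xke]] := idempotent_lift xk0.
have vxn n : v * x ^+ n = v by elim: n => [|n IHn]; rewrite ?mulr1 // exprS mulrA vx.
exists (x ^+ k.+1 * q); split=> //; last first.
  move=> e0; apply: vw; move: xke; rewrite e0 mulr0 => xk.
  by rewrite -(vxn k.+1) -xk mulr0 mul0r.
by rewrite exprS -mulrA; apply: right_idealM => //; apply: UI.
Qed.

(** Among the idempotents [e] of [I], choose one whose right annihilator [K]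
    in [I] is minimal.  An idempotent [f <> 0] of [K] would yield the
    idempotent [e + f - f e] of [I], whose annihilator is smaller; so [K] is
    nilpotent by the previous lemma. *)
Lemma right_ideal_idempotent I : right_ideal I ->
  exists e, [/\ I e, e * e = e & nilpotent_ideal [set x | I x /\ e * x = 0]].
Proof.
move=> idI.
pose P K := exists e, [/\ I e, e * e = e & K = [set x | I x /\ e * x = 0]].
have [|K [idK [e [Ie ee defK]] minK]] := minimal_right_ideal (P := P) idI.
  exists 0; split; [exact: right_ideal0 | exact: mulr0 |].
  by apply/seteqP; split=> x /=; [rewrite mul0r | case].
exists e; split=> //; rewrite -defK; apply: contrapT => nnK.
have [f [Kf ff]] := idempotent_of_nonnilpotent idK nnK; apply.
move: (Kf); rewrite {1}defK => -[If ef].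
pose e' := e + f - f * e.
have e'f : e' * f = f by rewrite /e' mulrBl mulrDl -mulrA ef ff mulr0 add0r subr0.
have ee' : e * e' = e by rewrite /e' mulrBr mulrDr ee mulrA ef mul0r addr0 subr0.
have Ie' : I e'.
  by apply: right_idealB; [| exact: right_idealD | exact: right_idealM].
have e'e' : e' * e' = e'.
  have e'e : e' * e = e by rewrite /e' mulrBl mulrDl ee -mulrA ee addrK.
  by rewrite {2}/e' mulrBr mulrDr mulrA e'f e'e.
rewrite -e'f; suff /(_ f Kf)[] : K `<=` [set x | I x /\ e' * x = 0] by [].
apply: minK; [exact: right_ideal_rann | by exists e' |].
by rewrite defK => x [Ix e'x]; split=> //; rewrite -ee' -mulrA e'x mulr0.
Qed.

(** The Jacobson radical.  Allowing factors on both sides of [x] and asking for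
    right inverses only makes it a two-sided ideal by plain computation. *)
Definition radical : set R :=
  [set x | forall a b, exists c, (1 - a * x * b) * c = 1].

Lemma radical_ideal : right_ideal radical.
Proof.
split=> [a b|x y Jx Jy a b|x z Jx a b].
- by exists 1; rewrite mulr0 mul0r subr0 mulr1.
- have [c xc] := Jx a b; have [d yd] := Jy (- a) (b * c).
  exists (c * d); rewrite mulrA -[RHS]yd; congr (_ * _).
  by rewrite mulrBr (mulrBl b) opprB addrCA mulrDl xc !mulNr opprK mulrA addrC.
- by have [c xc] := Jx a (z * b); exists c; rewrite -[RHS]xc !mulrA.
Qed.

Lemma radical_mull x z : radical x -> radical (z * x).
Proof. by move=> Jx a b; have [c xc] := Jx (a * z) b; exists c; rewrite -[RHS]xc !mulrA. Qed.

Lemma radical_idempotent e : radical e -> e * e = e -> e = 0.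
Proof.
move=> /(_ 1 1)[c ec] ee; rewrite mul1r mulr1 in ec.
by rewrite -[LHS]mulr1 -ec mulrA mulrBr mulr1 ee subrr mul0r.
Qed.

(** A non-nilpotent radical would contain an idempotent [e <> 0], whereas
    [1 - e] is right invertible only for [e = 0]. *)
Lemma radical_nilpotent : nilpotent_ideal radical.
Proof.
apply: contrapT => nnJ.
have [e [Je ee]] := idempotent_of_nonnilpotent radical_ideal nnJ.
by case; apply: radical_idempotent.
Qed.

Lemma nilpotent_sub_radical N : right_ideal N -> nilpotent_ideal N -> N `<=` radical.
Proof.
move=> idN nilN x Nx a b.
have [|k xbak] := nilpotent_ideal_exp (y := x * b * a) nilN.
  by do 2!apply: right_idealM => //.
have axb0 : (a * x * b) ^+ k.+2 = 0.
  suff h n : (a * x * b) ^+ n.+1 = a * (x * b * a) ^+ n * (x * b).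
    by rewrite h xbak mulr0 mul0r.
  elim: n => [|n IHn]; first by rewrite mulr1 mulrA.
  by rewrite exprS IHn [in RHS]exprS !mulrA.
exists (\sum_(i < k.+2) (a * x * b) ^+ i).
by apply: oppr_inj; rewrite -mulNr opprB -subrX1 axb0 sub0r.
Qed.

Section SemisimpleLayer.
Variables (X B : set R).
Hypotheses (idX : right_ideal X) (idB : right_ideal B).
Hypothesis XJ : forall x j, X x -> radical j -> B (x * j).

(** Modulo the radical every right ideal is generated by an idempotent; applied
    to the right ideal of all [r] with [x r] in [K + B], this produces a
    complement of [K] in [K + x R] modulo [B]. *)
Lemma layer_complement K x : right_ideal K -> K `<=` X -> X x ->
  ~ (exists2 y, K y & B (x - y)) ->
  exists a, ~ (exists2 y, K y & B (x * a - y)) /\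
    forall r, (exists2 y, K y & B (x * a * r - y)) -> B (x * a * r).
Proof.
move=> idK KX Xx xKB.
pose I : set R := [set r | exists2 y, K y & B (x * r - y)].
have idI : right_ideal I.
  split=> [|r s [y Ky ry] [z Kz sz]|r a [y Ky ry]].
  - by exists 0; [apply: right_ideal0|rewrite mulr0 subr0; apply: right_ideal0].
  - exists (y - z); first exact: right_idealB.
    have -> : x * (r - s) - (y - z) = (x * r - y) - (x * s - z).
      by rewrite mulrBr subrACA.
    exact: right_idealB.
  - exists (y * a); first exact: right_idealM.
    by rewrite mulrA -mulrBl; apply: right_idealM.
have [e [Ie ee nilN]] := right_ideal_idempotent idI.
exists (1 - e); split=> [xeKB|r].
  apply: xKB; suff: I 1 by case=> y Ky; exists y => //; rewrite -[x]mulr1.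
  by rewrite -[1](subrK e); apply: right_idealD.
rewrite -mulrA => xr; apply: XJ => //.
apply: nilpotent_sub_radical nilN _ _; first exact: right_ideal_rann.
by split=> //; rewrite mulrA mulrBr mulr1 ee subrr mul0r.
Qed.

(** The core of the noetherian property of a layer.  Were an ascending chain not
    stationary modulo [B], the complements [x_n R] of [K_n] inside [K_{n+1}]
    would be independent modulo [B], and the tails
    [B + x_n R + x_{n+1} R + ...] would descend strictly. *)
Lemma layer_independent (K : nat -> set R) (x : nat -> R) :
  (forall n, right_ideal (K n)) -> (forall n, K n `<=` K n.+1) ->
  (forall n, K n.+1 (x n)) ->
  (forall n, ~ B (x n)) ->
  (forall n r, (exists2 y, K n y & B (x n * r - y)) -> B (x n * r)) -> False.
Proof.
move=> idK Kmono Kx nBx indep.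
have Kle : {homo K : m n / (m <= n)%N >-> m `<=` n}.
  by apply: homo_leq Kmono => [U y|V U W UV VW y /UV /VW].
pose C n : set R := [set y | exists2 r : nat -> R,
  (forall m, (m < n)%N -> r m = 0) &
  exists L, forall M, (L <= M)%N -> B (y - \sum_(m < M) x m * r m)].
have idC n : right_ideal (C n).
  split=> [|y z [r r0 [L yL]] [s s0 [L' zL']]|y a [r r0 [L yL]]].
  - exists (fun=> 0) => //; exists 0%N => M _.
    by rewrite big1 => [|m _]; rewrite ?mulr0 // subrr; apply: right_ideal0.
  - exists (fun m => r m - s m) => [m mn|]; first by rewrite r0 // s0 // subrr.
    exists (maxn L L') => M; rewrite geq_max => /andP[LM L'M].
    under eq_bigr do rewrite mulrBr.
    rewrite sumrB subrACA.
    by apply: right_idealB; [|apply: yL|apply: zL'].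
  - exists (fun m => r m * a) => [m mn|]; first by rewrite r0 // mul0r.
    exists L => M /yL By; under eq_bigr do rewrite mulrA.
    by rewrite -mulr_suml -mulrBl; apply: right_idealM.
have Cmono n : C n.+1 `<=` C n.
  by move=> y [r r0 yL]; exists r => // m mn; apply: r0; apply: ltnW.
have [N stat] := artR idC Cmono.
have CN : C N (x N).
  exists (fun m => (m == N)%:R) => [m|]; first by case: ltngtP.
  exists N.+1 => M NM; rewrite (bigD1 (Ordinal NM)) //= eqxx mulr1 big1.
    by rewrite addr0 subrr; apply: right_ideal0.
  by move=> m /eqP mN; case: eqP => [mN'|]; rewrite ?mulr0 //; case: mN; apply: val_inj.
have [r r0 [L /(_ L (leqnn L))]] : C N.+1 (x N) by rewrite stat.
elim: L => [|L IHL]; first by rewrite big_ord0 subr0; apply: nBx.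
rewrite big_ord_recr /= opprD addrA => Bx; apply: IHL.
(* by independence, the last term of the sum is in [B] once it is in [K L + B] *)
suff BL : B (x L * r L).
  by rewrite -[_ - _](subrK (x L * r L)); apply: right_idealD.
have [LN|NL] := leqP L N; first by rewrite r0 // mulr0; apply: right_ideal0.
apply: indep; exists (x N - \sum_(i < L) x i * r i).
  apply: right_idealB => //; first exact: Kle (Kx N).
  apply: (big_ind (K L)) => [||i _]; first exact: right_ideal0.
    by move=> *; apply: right_idealD.
  by apply: right_idealM => //; apply: Kle (Kx i).
by rewrite -opprB; apply: right_idealN.
Qed.

Lemma layer_noetherian (K : nat -> set R) :
  (forall n, right_ideal (K n)) -> (forall n, K n `<=` K n.+1) ->
  (forall n, K n `<=` X) ->
  exists N : nat, forall n x, (N <= n)%N -> K n x -> exists2 y, K N y & B (x - y).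
Proof.
move=> idK Kmono KX.
have Kle : {homo K : m n / (m <= n)%N >-> m `<=` n}.
  by apply: homo_leq Kmono => [U y|V U W UV VW y /UV /VW].
apply: contrapT => noN.
have step (N : nat) : exists nx : nat * R, [/\ (N <= nx.1)%N, K nx.1 nx.2,
    ~ B nx.2 & forall r, (exists2 y, K N y & B (nx.2 * r - y)) -> B (nx.2 * r)].
  apply: contrapT => noStep; apply: noN; exists N => n x Nn Kx.
  apply: contrapT => xKB.
  have [a [xa indep]] := layer_complement (idK N) (KX N) (KX n x Kx) xKB.
  apply: noStep; exists (n, x * a); split=> //=; first exact: right_idealM.
  by move=> Bxa; apply: xa; exists 0; [apply: right_ideal0 | rewrite subr0].
have [f fP] := choice step.
pose g n := iter n (fun m => (f m).1) 0%N.
apply: (@layer_independent (K \o g) (fun n => (f (g n)).2)) => n /=.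
- exact: idK.
- by apply: Kle; have [] := fP (g n).
- by have [] := fP (g n).
- by have [] := fP (g n).
- by move=> r; have [_ _ _] := fP (g n); apply.
Qed.

End SemisimpleLayer.

(** The left annihilator of the [k]-th power of the radical. *)
Fixpoint socle_layer k : set R :=
  if k is k'.+1 then [set x | forall j, radical j -> socle_layer k' (x * j)]
  else [set 0].

Lemma socle_layer_ideal k : right_ideal (socle_layer k).
Proof.
elim: k => [|k IHk]; split=> /=.
- by [].
- by move=> x y -> ->; rewrite subr0.
- by move=> x a ->; rewrite mul0r.
- by move=> j _; rewrite mul0r; apply: right_ideal0.
- by move=> x y xP yP j Jj; rewrite mulrBl; apply: right_idealB; [|apply: xP|apply: yP].
- by move=> x a xP j Jj; rewrite -mulrA; apply/xP/radical_mull.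
Qed.

(** Hopkins: the left annihilators of the powers of the radical form a finite
    filtration of [R] all of whose layers are killed by the radical. *)
Lemma right_artinian_noetherian (K : nat -> set R) :
  (forall n, right_ideal (K n)) -> (forall n, K n `<=` K n.+1) ->
  exists N : nat, forall n, (N <= n)%N -> K n `<=` K N.
Proof.
move=> idK Kmono.
have Kle : {homo K : m n / (m <= n)%N >-> m `<=` n}.
  by apply: homo_leq Kmono => [U y|V U W UV VW y /UV /VW].
have [k Jk] := radical_nilpotent.
have layers i : exists N : nat, forall n, (N <= n)%N -> K n `&` socle_layer i `<=` K N.
  elim: i => [|i [N1 IHi]].
    by exists 0%N => n _ x [_ ->]; apply: right_ideal0.
  have [|n|n||N2 N2P] := @layer_noetherian (socle_layer i.+1) (socle_layer i)
    (socle_layer_ideal i) _ (fun n => K n `&` socle_layer i.+1).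
  - by move=> x j /[apply].
  - exact: right_idealI (socle_layer_ideal _).
  - by move=> x [Kx Sx]; split=> //; apply: Kmono.
  - by move=> n x [].
  exists (maxn N1 N2) => n; rewrite geq_max => /andP[N1n N2n] x Kx.
  have [y [Ky _] Sxy] := N2P n x N2n Kx.
  have KNy : K (maxn N1 N2) y by apply: Kle Ky; apply: leq_maxr.
  rewrite -[x](subrK y); apply: right_idealD => //.
  apply: (Kle N1); first exact: leq_maxl.
  apply: (IHi n N1n); split=> //; apply: right_idealB => //; first exact: Kx.1.
  exact: Kle Ky.
have top x : socle_layer k x.
  have := annihilated_mul x Jk; rewrite mulr1.
  by elim: {Jk} k x => //= k IHk x xP j Jj; apply/IHk/xP.
have [N NP] := layers k.
by exists N => n Nn x Kx; apply: (NP n Nn).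
Qed.

End RightIdeals.

(** * Abelian categories *)

Section Additive.
Local Open Scope ring_scope.
Variable C : preadditive.
Implicit Types W X Y Z M P Q : C.

Lemma hcomp0l X Y Z (f : hom X Y) : (0 : hom Y Z) \oc f = 0.
Proof. by apply: (addrI (0 \oc f)); rewrite -hcompDl !addr0. Qed.

Lemma hcomp0r X Y Z (g : hom Y Z) : g \oc (0 : hom X Y) = 0.
Proof. by apply: (addrI (g \oc 0)); rewrite -hcompDr !addr0. Qed.

Lemma hcompNl X Y Z (g : hom Y Z) (f : hom X Y) : (- g) \oc f = - (g \oc f).
Proof. by apply: (addrI (g \oc f)); rewrite -hcompDl !subrr hcomp0l. Qed.

Lemma hcompNr X Y Z (g : hom Y Z) (f : hom X Y) : g \oc (- f) = - (g \oc f).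
Proof. by apply: (addrI (g \oc f)); rewrite -hcompDr !subrr hcomp0r. Qed.

Lemma hcompBl X Y Z (g h : hom Y Z) (f : hom X Y) :
  (g - h) \oc f = g \oc f - h \oc f.
Proof. by rewrite hcompDl hcompNl. Qed.

Lemma hcompBr X Y Z (g : hom Y Z) (f h : hom X Y) :
  g \oc (f - h) = g \oc f - g \oc h.
Proof. by rewrite hcompDr hcompNr. Qed.

Lemma epimorphism0P X Y (f : hom X Y) :
  epimorphism f <-> forall Z (u : hom Y Z), u \oc f = 0 -> u = 0.
Proof.
split=> [epf Z u uf|f0 Z u v uv]; first by apply: epf; rewrite uf hcomp0l.
by apply/subr0_eq/f0; rewrite hcompBl uv subrr.
Qed.

Lemma epimorphism_comp X Y Z (g : hom Y Z) (f : hom X Y) :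
  epimorphism g -> epimorphism f -> epimorphism (g \oc f).
Proof. by move=> epg epf W u v; rewrite !hcompA => /epf /epg. Qed.

Lemma is_kernel_mono K X Y (k : hom K X) (f : hom X Y) :
  is_kernel k f -> monomorphism k.
Proof.
move=> [fk kP] W u v kuv; have [|t [_ uniq_t]] := kP W (k \oc u).
  by rewrite hcompA fk hcomp0l.
by rewrite -(uniq_t u erefl) -(uniq_t v (esym kuv)).
Qed.

Lemma is_cokernel_epi X Y Q (q : hom Y Q) (f : hom X Y) :
  is_cokernel q f -> epimorphism q.
Proof.
move=> [qf qP] W u v uvq; have [|t [_ uniq_t]] := qP W (u \oc q).
  by rewrite -hcompA qf hcomp0r.
by rewrite -(uniq_t u erefl) -(uniq_t v (esym uvq)).
Qed.

Lemma is_kernel_factor K X Y (k : hom K X) (f : hom X Y) W (t : hom W X) :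
  is_kernel k f -> f \oc t = 0 -> exists u, k \oc u = t.
Proof. by move=> [_ kP] /kP[u [ku _]]; exists u. Qed.

Lemma is_cokernel_factor X Y Q (q : hom Y Q) (f : hom X Y) W (t : hom Y W) :
  is_cokernel q f -> t \oc f = 0 -> exists u, u \oc q = t.
Proof. by move=> [_ qP] /qP[u [uq _]]; exists u. Qed.

Definition factors W X (U : subobject X) (h : hom W X) : Prop :=
  exists t, sub_mor U \oc t = h.

Lemma factors_le W X (U V : subobject X) (h : hom W X) :
  sub_le U V -> factors U h -> factors V h.
Proof. by move=> [s Vs] [t <-]; exists (s \oc t); rewrite hcompA Vs. Qed.

Lemma factors_comp W W' X (U : subobject X) (h : hom W X) (g : hom W' W) :
  factors U h -> factors U (h \oc g).
Proof. by move=> [t <-]; exists (t \oc g); rewrite hcompA. Qed.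

Lemma generator_separates M X Z (u : hom X Z) :
  generator M -> (forall h : hom M X, u \oc h = 0) -> u = 0.
Proof.
move=> /(_ X)[I [S [inj [e [copS epe]]]]] uM.
apply: (epimorphism0P e).1 => //; have [w [_ uniq_w]] := copS Z (fun=> 0).
rewrite -(uniq_w (u \oc e)) => [|i]; last by rewrite -hcompA.
by apply: uniq_w => i; rewrite hcomp0l.
Qed.

End Additive.

Section Abelian.
Local Open Scope ring_scope.
Variable C : preadditive.
Implicit Types W X Y Z M P Q : C.
Hypothesis abC : is_abelian C.

Lemma mono_is_kernel_of_epi X Y (f : hom X Y) : monomorphism f ->
  exists Q (q : hom Y Q), epimorphism q /\ is_kernel f q.
Proof.
move=> /(ab_monic_normal abC)[Z [g kerf]].
have [Q [q cokq]] := ab_cokernel abC f.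
exists Q, q; split; first exact: is_cokernel_epi cokq.
split=> [|W t qt]; first by case: cokq.
have [w wq] := is_cokernel_factor cokq kerf.1.
by apply: kerf.2; rewrite -wq -hcompA qt hcomp0r.
Qed.

Lemma epi_is_cokernel_of_kernel X Y K (f : hom X Y) (k : hom K X) :
  epimorphism f -> is_kernel k f -> is_cokernel f k.
Proof.
move=> /(ab_epic_normal abC)[W [g cokf]] kerk.
split=> [|Z t tk]; first by case: kerk.
have [w kw] := is_kernel_factor kerk cokf.1.
by apply: cokf.2; rewrite -kw hcompA tk hcomp0l.
Qed.

(** With [k] the kernel of [f p1 - m p2 : X + W -> Y], which is epi since [f]
    is, a map [u] with [u p2 k = 0] makes [u p2] factor as [w (f p1 - m p2)];
    restricting to [X] shows [w f = 0], so [w = 0] and [u = 0]. *)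
Lemma epi_pullback X Y W (f : hom X Y) (m : hom W Y) : epimorphism f ->
  exists S (a : hom S X) (b : hom S W), f \oc a = m \oc b /\ epimorphism b.
Proof.
move=> epf.
have [T [i1 [i2 [p1 [p2 [pi11 pi22 pi12 pi21 ip]]]]]] := ab_biproduct abC X W.
pose d := f \oc p1 - m \oc p2.
have di1 : d \oc i1 = f.
  by rewrite hcompBl -!hcompA pi11 pi21 hcomp_idr hcomp0r subr0.
have epd : epimorphism d.
  apply/epimorphism0P => Z u ud; apply: ((epimorphism0P f).1 epf).
  by rewrite -di1 hcompA ud hcomp0l.
have [S [k kerk]] := ab_kernel abC d.
have cokd := epi_is_cokernel_of_kernel epd kerk.
exists S, (p1 \oc k), (p2 \oc k); split.
  by apply/subr0_eq; rewrite !hcompA -hcompBl; case: kerk.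
apply/epimorphism0P => Z u; rewrite hcompA => upk.
have [w wd] := is_cokernel_factor cokd upk.
have w0 : w = 0.
  apply: ((epimorphism0P f).1 epf).
  by rewrite -di1 hcompA wd -hcompA pi21 hcomp0r.
by rewrite -[u]hcomp_idr -pi22 hcompA -wd w0 !hcomp0l.
Qed.

Lemma idempotent_splits M (e : hom M M) : e \oc e = e ->
  exists P (i : hom P M) (p : hom M P), p \oc i = idm P /\ i \oc p = e.
Proof.
move=> ee; have [P [i keri]] := ab_kernel abC (idm M - e).
have [|p ip] := is_kernel_factor keri (t := e).
  by rewrite hcompBl hcomp_idl ee subrr.
exists P, i, p; split=> //; apply: (is_kernel_mono keri).
rewrite hcompA ip hcomp_idr; apply/esym/subr0_eq.
by rewrite -[X in X - _]hcomp_idl -hcompBl; case: keri.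
Qed.

Lemma retract_direct_summand P M (i : hom P M) (p : hom M P) :
  p \oc i = idm P -> direct_summand P M.
Proof.
move=> pi; have [|Q [j [q [qj jq]]]] := @idempotent_splits M (idm M - i \oc p).
  rewrite hcompBl hcomp_idl hcompBr hcomp_idr -hcompA (hcompA p) pi hcomp_idl.
  by rewrite subrr subr0.
have jqj : j = (j \oc q) \oc j by rewrite -hcompA qj hcomp_idr.
have qjq : q = q \oc (j \oc q) by rewrite hcompA qj hcomp_idl.
exists Q, i, j, p, q; split=> //.
- by rewrite jqj jq hcompBl hcomp_idl hcompBr !hcompA pi hcomp_idl subrr.
- by rewrite qjq jq hcompBr hcomp_idr hcompBl -!hcompA pi hcomp_idr subrr.
- by rewrite jq addrC subrK.
Qed.

Lemma sub_le_of_factors M X (U V : subobject X) : generator M ->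
  (forall h : hom M X, factors U h -> factors V h) -> sub_le U V.
Proof.
move=> genM UV; have [Q [q [_ kerV]]] := mono_is_kernel_of_epi (@sub_monic _ _ V).
apply: (is_kernel_factor kerV); apply: (generator_separates genM) => h.
rewrite -hcompA; have [|t <-] := UV (sub_mor U \oc h); first by exists h.
by rewrite hcompA kerV.1 hcomp0l.
Qed.

(** The pullback of [f] along [g] is epi onto [M] and is itself covered by maps
    from [M]. *)
Lemma epi_lift_dense M X Y (f : hom X Y) (g : hom M Y) : generator M ->
  epimorphism f -> forall Z (u : hom M Z),
  (forall y : hom M M, (exists h, f \oc h = g \oc y) -> u \oc y = 0) -> u = 0.
Proof.
move=> genM epf Z u uy; have [S [a [b [fagb epb]]]] := epi_pullback g epf.
apply: (epimorphism0P b).1 => //; apply: (generator_separates genM) => h.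
by rewrite -hcompA; apply: uy; exists (a \oc h); rewrite !hcompA fagb.
Qed.

Lemma subobject_preimage X Y (q : hom X Y) (U : subobject Y) :
  exists V : subobject X,
    forall W (h : hom W X), factors V h <-> factors U (q \oc h).
Proof.
have [Z [g [_ kerU]]] := mono_is_kernel_of_epi (@sub_monic _ _ U).
have [K [k kerk]] := ab_kernel abC (g \oc q).
exists (Subobject (is_kernel_mono kerk)) => W h; split=> [[t <-]|[t Ut]] /=.
  by apply: (is_kernel_factor kerU); rewrite !hcompA kerk.1 hcomp0l.
apply: (is_kernel_factor kerk).
by rewrite -hcompA -Ut hcompA kerU.1 hcomp0l.
Qed.

(** A subobject of a quotient is determined by its inverse image, because the
    pullback of an epimorphism is an epimorphism. *)
Lemma preimage_sub_le X Y (q : hom X Y) (U U' : subobject Y)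
    (V V' : subobject X) : epimorphism q ->
  (forall W (h : hom W X), factors V h <-> factors U (q \oc h)) ->
  (forall W (h : hom W X), factors V' h <-> factors U' (q \oc h)) ->
  sub_le V V' <-> sub_le U U'.
Proof.
move=> epq VP VP'; split=> [VV'|UU'].
  have [S [a [b [qaUb epb]]]] := epi_pullback (sub_mor U) epq.
  have /VP' : factors V' a by apply: (factors_le VV'); apply/VP; exists b.
  have [Z [g [_ kerU']]] := mono_is_kernel_of_epi (@sub_monic _ _ U').
  move=> [t U't]; apply: (is_kernel_factor kerU').
  apply: (epimorphism0P b).1 => //.
  by rewrite -hcompA -qaUb -U't hcompA kerU'.1 hcomp0l.
apply/VP'; apply: (factors_le UU'); apply/VP.
by exists (idm _); rewrite hcomp_idr.
Qed.

Lemma finite_length_quotient X Y (q : hom X Y) :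
  epimorphism q -> finite_length X -> finite_length Y.
Proof.
move=> epq [artX noeX].
have [V VP] := choice (subobject_preimage q).
have leVU U U' : sub_le (V U) (V U') <-> sub_le U U'.
  exact: preimage_sub_le epq (VP U) (VP U').
split=> U Umono.
  have [n|N NP] := artX (V \o U); first exact/leVU.
  by exists N => n /NP[] /leVU ? /leVU.
have [n|N NP] := noeX (V \o U); first exact/leVU.
by exists N => n /NP[] /leVU ? /leVU.
Qed.

(** The sum of the images of finitely many maps, obtained without any direct
    sum as the kernel of the universal quotient of [X] that kills them. *)
Lemma joint_image P X (s : seq (hom P X)) : exists V : subobject X,
  forall W (h : hom W X), factors V h <->
    forall Z (u : hom X Z), (forall t, t \in s -> u \oc t = 0) -> u \oc h = 0.
Proof.
have [Q [c [cs cP]]] : exists Q (c : hom X Q), (forall t, t \in s -> c \oc t = 0) /\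
    forall Z (u : hom X Z), (forall t, t \in s -> u \oc t = 0) ->
    exists w, u = w \oc c.
  elim: s => [|t s [Q [c [cs cP]]]].
    by exists X, (idm X); split=> // Z u _; exists u; rewrite hcomp_idr.
  have [Q' [q cokq]] := ab_cokernel abC (c \oc t).
  exists Q', (q \oc c); split=> [r|Z u us].
    rewrite inE => /predU1P[->|rs]; first by rewrite -hcompA cokq.1.
    by rewrite -hcompA cs // hcomp0r.
  have [r rs|w defu] := cP Z u; first by apply: us; rewrite inE rs orbT.
  have [|v vq] := is_cokernel_factor cokq (t := w).
    by rewrite hcompA -defu us // mem_head.
  by exists v; rewrite hcompA vq.
have [K [k kerk]] := ab_kernel abC c.
exists (Subobject (is_kernel_mono kerk)) => W h; split=> [[t <-] Z u /cP[w ->]|hP].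
  by rewrite -hcompA (hcompA c) kerk.1 hcomp0l hcomp0r.
exact/(is_kernel_factor kerk)/hP.
Qed.

(** Otherwise the joint images of longer and longer lists of maps would form a
    strictly ascending chain. *)
Lemma noetherian_finite_joint_epi P X : noetherian X ->
  (forall Z (u : hom X Z), (forall t : hom P X, u \oc t = 0) -> u = 0) ->
  exists s : seq (hom P X),
    forall Z (u : hom X Z), (forall t, t \in s -> u \oc t = 0) -> u = 0.
Proof.
move=> noeX epP; apply: contrapT => noS.
have step (s : seq (hom P X)) : exists t : hom P X, exists Z (u : hom X Z),
    (forall r, r \in s -> u \oc r = 0) /\ u \oc t <> 0.
  apply: contrapT => noT; apply: noS; exists s => Z u us; apply: epP => t.
  by apply: contrapT => ut; apply: noT; exists t, Z, u.
have [f fP] := choice step.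
have [V VP] := choice (@joint_image P X).
pose s n := iter n (fun s => f s :: s) [::].
have [n|N /(_ N.+1 (leqnSn N))[leV _]] := noeX (V \o s).
  have /VP Vs : factors (V (s n)) (sub_mor (V (s n))).
    by exists (idm _); rewrite hcomp_idr.
  apply/VP => Z u us; apply: Vs => r rs.
  by apply: us; rewrite inE rs orbT.
have [Z [u [us]]] := fP (s N); apply.
suff /VP : factors (V (s N)) (f (s N)) by apply.
by apply: (factors_le leV); apply/VP => Z' v; apply; apply: mem_head.
Qed.

End Abelian.

(** * Chain conditions on [Hom(M, X)] *)

Section HomModules.
Local Open Scope ring_scope.
Local Open Scope classical_set_scope.
Variables (C : preadditive) (M : C).
Implicit Types W X Y Z P Q : C.

Definition hom_submodule X (F : set (hom M X)) : Prop :=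
  [/\ F 0, forall x y, F x -> F y -> F (x - y)
    & forall x (a : hom M M), F x -> F (x \oc a)].

Definition hom_artinian X : Prop :=
  forall F : nat -> set (hom M X), (forall n, hom_submodule (F n)) ->
  (forall n, F n.+1 `<=` F n) ->
  exists N, forall n, (N <= n)%N -> F N `<=` F n.

Definition hom_noetherian X : Prop :=
  forall F : nat -> set (hom M X), (forall n, hom_submodule (F n)) ->
  (forall n, F n `<=` F n.+1) ->
  exists N, forall n, (N <= n)%N -> F n `<=` F N.

(** The right [End M]-module [Hom(M, X)] has finite length.  Unlike the same
    condition on subobjects of [X], this one passes to biproducts by plain
    module computations. *)
Definition hom_finite_length X : Prop := hom_artinian X /\ hom_noetherian X.

Lemma hom_finite_length_self :
  right_artinian (End_ring M) -> hom_finite_length M.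
Proof.
move=> artE; split=> F idF Fmono; last first.
  exact: (right_artinian_noetherian artE (K := F) idF Fmono).
by have [N NP] := artE F idF Fmono; exists N => n /NP ->.
Qed.

Lemma hom_finite_length0 Z : is_zero_object Z -> hom_finite_length Z.
Proof.
move=> Z0; have h0 (h : hom M Z) : h = 0.
  by have [[k [_ kP]] _] := Z0 M; rewrite -(kP h) // -(kP 0).
by split=> F idF _; exists 0%N => n _ h _; rewrite (h0 h); [case: (idF n) | case: (idF 0%N)].
Qed.

Lemma hom_submodule_comp X Y (g : hom Y X) (F : set (hom M X)) :
  hom_submodule F -> hom_submodule [set h : hom M Y | F (g \oc h)].
Proof.
move=> [F0 FB FM]; split=> [|x y|x a] /=; first by rewrite hcomp0r.
  by rewrite hcompBr; apply: FB.
by rewrite hcompA; apply: FM.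
Qed.

Lemma hom_submodule_image X Y (g : hom Y X) (F : set (hom M Y)) :
  hom_submodule F -> hom_submodule [set g \oc h | h in F].
Proof.
move=> [F0 FB FM]; split=> [|_ _ [x Fx <-] [y Fy <-]|_ a [x Fx <-]].
- by exists 0; rewrite ?hcomp0r.
- by exists (x - y); [apply: FB | rewrite hcompBr].
- by exists (x \oc a); [apply: FM | rewrite hcompA].
Qed.

Lemma hom_finite_length_retract X Y (i : hom Y X) (p : hom X Y) :
  p \oc i = idm Y -> hom_finite_length X -> hom_finite_length Y.
Proof.
move=> pi [artX noeX]; have ret (F F' : set (hom M Y)) :
    [set h | F (p \oc h)] `<=` [set h | F' (p \oc h)] -> F `<=` F'.
  by move=> FF' h; have := FF' (i \oc h); rewrite /= hcompA pi hcomp_idl.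
split=> F idF Fmono.
  have [n|n h|N NP] := artX (fun n => [set h | F n (p \oc h)]).
  - exact: hom_submodule_comp.
  - exact: Fmono.
  - by exists N => n /NP /ret.
have [n|n h|N NP] := noeX (fun n => [set h | F n (p \oc h)]).
- exact: hom_submodule_comp.
- exact: Fmono.
- by exists N => n /NP /ret.
Qed.

Section Biproduct.
Variables (X1 X2 Y : C).
Variables (i1 : hom X1 Y) (i2 : hom X2 Y) (p1 : hom Y X1) (p2 : hom Y X2).
Hypothesis bipY : is_biproduct i1 i2 p1 p2.

(** A submodule of [Hom(M, Y)] is determined, among those containing it, by its
    intersection with [Hom(M, X1)] and its image in [Hom(M, X2)]. *)
Lemma biproduct_submodule_sub (F G : set (hom M Y)) :
  hom_submodule F -> hom_submodule G -> G `<=` F ->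
  [set h | F (i1 \oc h)] `<=` [set h | G (i1 \oc h)] ->
  [set p2 \oc h | h in F] `<=` [set p2 \oc h | h in G] -> F `<=` G.
Proof.
move=> [_ FB _] [G0 GB _] GF sub1 sub2 h Fh.
have [h' Gh' ph'] : [set p2 \oc h | h in G] (p2 \oc h) by apply: sub2; exists h.
have defd : h - h' = i1 \oc (p1 \oc (h - h')).
  case: bipY => _ _ _ _ ip.
  rewrite -[LHS]hcomp_idl -ip hcompDl -!hcompA [p2 \oc _]hcompBr ph' subrr.
  by rewrite hcomp0r addr0.
have Gd : G (h - h') by rewrite defd; apply: sub1; rewrite /= -defd; apply/FB/GF.
have -> : h = (h - h') - (0 - h') by rewrite sub0r opprK subrK.
exact: (GB _ _ Gd (GB _ _ G0 Gh')).
Qed.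

Lemma hom_finite_length_biproduct :
  hom_finite_length X1 -> hom_finite_length X2 -> hom_finite_length Y.
Proof.
move=> [art1 noe1] [art2 noe2]; split=> F idF Fmono.
  have Fle : {homo F : m n / (m <= n)%N >-> n `<=` m}.
    by apply: homo_leq Fmono => [U y|V U W UV VW y /VW /UV].
  have [n|n h|N1 N1P] := art1 (fun n => [set h | F n (i1 \oc h)]).
  - exact: hom_submodule_comp.
  - exact: Fmono.
  have [n|n _ [h Fh <-]|N2 N2P] := art2 (fun n => [set p2 \oc h | h in F n]).
  - exact: hom_submodule_image.
  - by exists h => //; apply: Fmono.
  exists (maxn N1 N2) => n Nn; have := Nn; rewrite geq_max => /andP[N1n N2n].
  apply: biproduct_submodule_sub => // [|h /= FNh|_ [h FNh <-]].
  - exact: Fle.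
  - by apply: (N1P n N1n); apply: Fle FNh; apply: leq_maxl.
  - by apply: (N2P n N2n); exists h => //; apply: Fle FNh; apply: leq_maxr.
have Fle : {homo F : m n / (m <= n)%N >-> m `<=` n}.
  by apply: homo_leq Fmono => [U y|V U W UV VW y /UV /VW].
have [n|n h|N1 N1P] := noe1 (fun n => [set h | F n (i1 \oc h)]).
- exact: hom_submodule_comp.
- exact: Fmono.
have [n|n _ [h Fh <-]|N2 N2P] := noe2 (fun n => [set p2 \oc h | h in F n]).
- exact: hom_submodule_image.
- by exists h => //; apply: Fmono.
exists (maxn N1 N2) => n Nn; have := Nn; rewrite geq_max => /andP[N1n N2n].
apply: biproduct_submodule_sub => // [|h /= Fh|_ [h Fh <-]].
- exact: Fle.
- by apply: (Fle N1); [exact: leq_maxl | exact: N1P Fh].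
- have [|h' Fh' ph'] := N2P n N2n (p2 \oc h); first by exists h.
  by exists h' => //; apply: Fle Fh'; apply: leq_maxr.
Qed.

End Biproduct.

Hypothesis abC : is_abelian C.
Hypothesis genM : generator M.

Lemma factors_submodule X (U : subobject X) :
  hom_submodule [set h : hom M X | factors U h].
Proof.
split=> [|_ _ [s <-] [t <-]|h a] /=; first by exists 0; rewrite hcomp0r.
  by exists (s - t); rewrite hcompBr.
exact: factors_comp.
Qed.

Lemma hom_finite_length_finite_length X : hom_finite_length X -> finite_length X.
Proof.
have leU (U V : subobject X) : [set h : hom M X | factors U h] `<=`
    [set h | factors V h] -> sub_le U V by apply: sub_le_of_factors.
case=> artX noeX; split=> U Umono.
  have Ule : {homo U : m n / (m <= n)%N >-> sub_le n m}.
    apply: homo_leq Umono => [V|V W Z VW ZV]; last exact: factors_le VW ZV.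
    by exists (idm _); rewrite hcomp_idr.
  have [n|n h /= |N NP] := artX (fun n => [set h | factors (U n) h]).
  - exact: factors_submodule.
  - exact: factors_le.
  - by exists N => n Nn; split; [apply: Ule | apply/leU/NP].
have Ule : {homo U : m n / (m <= n)%N >-> sub_le m n}.
  apply: homo_leq Umono => [V|V W Z WV VZ]; last exact: factors_le VZ WV.
  by exists (idm _); rewrite hcomp_idr.
have [n|n h /= |N NP] := noeX (fun n => [set h | factors (U n) h]).
- exact: factors_submodule.
- exact: factors_le.
- by exists N => n Nn; split; [apply/leU/NP | apply: Ule].
Qed.

End HomModules.

(** * Copowers *)

Section Copowers.
Local Open Scope ring_scope.
Variable C : preadditive.
Implicit Types W X Y Z M P Q : C.

Definition is_copower P (I : smallType) T (inj : I -> hom P T) : Prop :=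
  is_coproduct (F := fun=> P) inj.

Lemma is_copower_factor P I T (inj : I -> hom P T) W (t : I -> hom P W) :
  is_copower inj -> exists u, forall i, u \oc inj i = t i.
Proof. by move=> /(_ W t)[u [uP _]]; exists u. Qed.

Lemma is_copower_ext P I T (inj : I -> hom P T) W (u v : hom T W) :
  is_copower inj -> (forall i, u \oc inj i = v \oc inj i) -> u = v.
Proof.
move=> /(_ W (fun i => v \oc inj i))[w [_ uniq_w]] uv.
by rewrite -(uniq_w u uv) -(uniq_w v).
Qed.

Lemma is_copowerI P (I : smallType) T (inj : I -> hom P T) :
  (forall W (t : I -> hom P W), exists u, forall i, u \oc inj i = t i) ->
  (forall W (u : hom T W), (forall i, u \oc inj i = 0) -> u = 0) ->
  is_copower inj.
Proof.
move=> ex uniq W t; have [u uP] := ex W t; exists u; split=> // v vP.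
by apply/subr0_eq/uniq => i; rewrite hcompBl uP vP subrr.
Qed.

Lemma is_copower1 P : is_copower (fun _ : unit => idm P).
Proof.
apply: is_copowerI => [W t|W u uP]; last by rewrite -[u]hcomp_idr (uP tt).
by exists (t tt) => -[]; rewrite hcomp_idr.
Qed.

Lemma is_copower0 P Z : is_zero_object Z ->
  is_copower (fun i : void => of_void (hom P Z) i).
Proof.
move=> Z0; apply: is_copowerI => [W t|W u _]; first by exists 0 => -[].
by have [_ [w [_ wP]]] := Z0 W; rewrite -(wP u) // -(wP 0).
Qed.

Lemma is_copowerD P I1 I2 T1 T2 (inj1 : I1 -> hom P T1) (inj2 : I2 -> hom P T2)
    T (i1 : hom T1 T) (i2 : hom T2 T) (p1 : hom T T1) (p2 : hom T T2) :
  is_biproduct i1 i2 p1 p2 -> is_copower inj1 -> is_copower inj2 ->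
  is_copower (fun i : I1 + I2 => match i with
                | inl j => i1 \oc inj1 j
                | inr j => i2 \oc inj2 j end).
Proof.
move=> [pi11 pi22 pi12 pi21 ip] cop1 cop2; apply: is_copowerI => [W t|W u uP].
  have [u1 u1P] := is_copower_factor (t \o inl) cop1.
  have [u2 u2P] := is_copower_factor (t \o inr) cop2.
  exists (u1 \oc p1 + u2 \oc p2) => -[] j.
    rewrite hcompA (hcompDl _ _ i1) -!hcompA pi11 pi21 hcomp_idr hcomp0r addr0.
    exact: u1P.
  rewrite hcompA (hcompDl _ _ i2) -!hcompA pi12 pi22 hcomp_idr hcomp0r add0r.
  exact: u2P.
rewrite -[u]hcomp_idr -ip hcompDr !hcompA.
have -> : u \oc i1 = 0.
  apply: (is_copower_ext cop1) => j.
  by rewrite -hcompA (uP (inl j)) hcomp0l.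
have -> : u \oc i2 = 0.
  apply: (is_copower_ext cop2) => j.
  by rewrite -hcompA (uP (inr j)) hcomp0l.
by rewrite !hcomp0l addr0.
Qed.

Hypothesis abC : is_abelian C.

(** The copower of [P] splits off the copower of [M] as the image of the
    idempotent acting on each summand as the projection onto [P]. *)
Lemma copower_retract P M (i : hom P M) (p : hom M P) I S (inj : I -> hom M S) :
  p \oc i = idm P -> is_copower inj ->
  exists T (inj' : I -> hom P T), is_copower inj'.
Proof.
move=> pi copS.
have [phi phiP] := is_copower_factor (fun j => inj j \oc (i \oc p)) copS.
have [|T [k [q [qk kq]]]] := @idempotent_splits _ abC _ phi.
  apply: (is_copower_ext copS) => j.
  by rewrite -hcompA phiP hcompA phiP -!hcompA (hcompA p) pi hcomp_idl.
exists T, (fun j => q \oc inj j \oc i).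
apply: is_copowerI => [W t|W u uP].
  have [u uP] := is_copower_factor (fun j => t j \oc p) copS.
  exists (u \oc k) => j; rewrite -hcompA (hcompA k) (hcompA k) kq phiP.
  by rewrite -!hcompA pi hcomp_idr hcompA uP -hcompA pi hcomp_idr.
rewrite -[u]hcomp_idr -qk hcompA.
have -> : u \oc q = 0; last by rewrite hcomp0l.
apply: (is_copower_ext copS) => j; rewrite hcomp0l.
have -> : q = q \oc phi by rewrite -kq hcompA qk hcomp_idl.
have := uP j; rewrite -!hcompA phiP !hcompA => ->.
by rewrite hcomp0l.
Qed.

(** Asking only for [K u], instead of [u = 0], lets covers be assembled one map at
    a time: [K u] will say that [u] kills a given map into [X].  The class [D]
    is the one in which the copower must be found. *)
Definition copower_cover (D : C -> Prop) P X (K : forall Z, hom X Z -> Prop) :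
    Prop :=
  exists (I : smallType) T (inj : I -> hom P T) (e : hom T X),
    [/\ is_copower inj, D T & forall Z (u : hom X Z), u \oc e = 0 -> K Z u].

Lemma copower_cover_seq (D : C -> Prop) P X (A : eqType)
    (K : A -> forall Z, hom X Z -> Prop) (s : seq A) :
  (forall Z, is_zero_object Z -> D Z) ->
  (forall X1 X2 Y (i1 : hom X1 Y) (i2 : hom X2 Y) p1 p2,
     is_biproduct i1 i2 p1 p2 -> D X1 -> D X2 -> D Y) ->
  (forall a, a \in s -> copower_cover D P (K a)) ->
  copower_cover D P (fun Z u => forall a, a \in s -> K a Z u).
Proof.
move=> D0 DD; elim: s => [|a s IHs] covs.
  have [Z Z0] := ab_zero abC.
  exists void, Z, (fun i => of_void (hom P Z) i), 0; split=> //.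
    exact: is_copower0.
  exact: D0.
have [I1 [T1 [inj1 [e1 [cop1 D1 K1]]]]] := covs a (mem_head _ _).
have [b bs|I2 [T2 [inj2 [e2 [cop2 D2 K2]]]]] := IHs.
  by apply: covs; rewrite inE bs orbT.
have [T [i1 [i2 [p1 [p2 bipT]]]]] := ab_biproduct abC T1 T2.
exists (I1 + I2)%type, T; eexists; exists (e1 \oc p1 + e2 \oc p2).
split; [exact: is_copowerD bipT cop1 cop2 | exact: DD bipT D1 D2 |].
case: bipT => pi11 pi22 pi12 pi21 _ Z u ue b; rewrite inE => /predU1P[->|].
  apply: K1; have := congr1 (hcomp^~ i1) ue.
  by rewrite -hcompA hcompDl -!hcompA pi11 pi21 hcomp_idr !hcomp0r addr0 hcomp0l.
apply: K2; have := congr1 (hcomp^~ i2) ue.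
by rewrite -hcompA hcompDl -!hcompA pi12 pi22 hcomp_idr !hcomp0r add0r hcomp0l.
Qed.

End Copowers.

(** * The projective summand *)

Section ProjectiveSummand.
Local Open Scope ring_scope.
Local Open Scope classical_set_scope.
Variables (C : preadditive) (M : C).
Hypotheses (abC : is_abelian C) (genM : generator M).
Implicit Types (W X Y Z P Q : C) (I J : set (End_ring M)).

(** The analogue of the Gabriel topology on [End M] in the Gabriel-Popescu
    theorem. *)
Definition dense_ideal J : Prop :=
  forall Z (u : hom M Z), (forall x, J x -> u \oc (x : hom M M) = 0) -> u = 0.

Lemma dense_ideal_setT : dense_ideal setT.
Proof. by move=> Z u /(_ 1 Logic.I) /=; rewrite hcomp_idr. Qed.

(** The endomorphisms [z] in [I] for which [g z] lifts through [f] form a right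
    ideal.  It is dense: for [x] in [I], the [y] such that [g x y] lifts are
    jointly epi by [epi_lift_dense].  So it is all of [I] by minimality. *)
Lemma minimal_dense_ideal_lift I : right_ideal I -> dense_ideal I ->
  (forall J, right_ideal J -> dense_ideal J -> J `<=` I -> I `<=` J) ->
  forall X Y (f : hom X Y) (g : hom M Y) (x : hom M M),
  epimorphism f -> I x -> exists h, f \oc h = g \oc x.
Proof.
move=> idI denI minI X Y f g x epf Ix.
pose J : set (End_ring M) :=
  [set z | I z /\ exists h, f \oc h = g \oc (z : hom M M)].
suff /(_ x Ix)[] : I `<=` J by [].
apply: minI => [||z []//].
  split=> [|y z [Iy [h fh]] [Iz [k fk]]|z a [Iz [h fh]]].
  - by split; [exact: right_ideal0 | exists 0; rewrite !hcomp0r].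
  - split; first exact: right_idealB.
    by exists (h - k); rewrite !hcompBr fh fk.
  - split; first exact: right_idealM.
    by exists (h \oc a); rewrite hcompA fh -hcompA.
move=> Z u uJ; apply: denI => y Iy.
apply: (epi_lift_dense abC (g := g \oc y) genM epf) => z [h fh].
rewrite -hcompA; apply: (uJ ((y : End_ring M) * z)); split.
  exact: right_idealM.
by exists h; rewrite fh -hcompA.
Qed.

(** If [u] kills [E e] and [N] is the right annihilator of [e] in [I], then
    [u x N^k = 0] implies [u x = 0]: every [a] in [I] is congruent to an element
    [a - e a] of [N] modulo [E e E], and [I] is dense. *)
Lemma dense_ideal_idempotent I (e : End_ring M) : right_ideal I ->
  dense_ideal I -> I e -> e * e = e ->
  nilpotent_ideal [set x | I x /\ e * x = 0] ->
  forall Z (u : hom M Z),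
  (forall x : hom M M, u \oc (x \oc (e : hom M M)) = 0) -> u = 0.
Proof.
move=> idI denI Ie ee [k nilN] Z u ue; rewrite -[u]hcomp_idr.
suff: forall x, annihilated [set y | I y /\ e * y = 0] k x ->
    u \oc (x : hom M M) = 0 by apply.
elim: {nilN} k => [|k IHk] x /= xN; first by rewrite xN hcomp0r.
apply: denI => a Ia; rewrite -hcompA.
have -> : x \oc a = (x * (a - e * a)) + (x \oc e) \oc (a : hom M M).
  by rewrite mulrBr -hcompA subrK.
rewrite hcompDr hcompA ue hcomp0l addr0; apply/IHk/xN; split.
  by apply: right_idealB => //; apply: right_idealM.
by rewrite mulrBr mulrA ee subrr.
Qed.

Hypothesis artE : right_artinian (End_ring M).

Lemma exists_projective_summand : exists P (i : hom P M) (p : hom M P),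
  [/\ p \oc i = idm P, projective P &
    forall Z (u : hom M Z), (forall t : hom P M, u \oc t = 0) -> u = 0].
Proof.
have [I [idI denI minI]] :=
  minimal_right_ideal artE (@right_ideal_setT _) dense_ideal_setT.
have [e [Ie ee nilN]] := right_ideal_idempotent artE idI.
have [P [i [p [pi ip]]]] := idempotent_splits abC (ee : e \oc e = e).
exists P, i, p; split=> // [X Y f epf g|Z u uP].
  have [h fh] := minimal_dense_ideal_lift idI denI minI (g \oc p) epf Ie.
  exists (h \oc i); rewrite hcompA fh -ip.
  by rewrite -!hcompA pi hcomp_idr pi hcomp_idr.
apply: (dense_ideal_idempotent idI denI Ie ee nilN) => x.
by rewrite -ip (hcompA x) hcompA uP hcomp0l.
Qed.

End ProjectiveSummand.

(** * Generation, in the category and among the objects of finite length *)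

Section Generators.
Local Open Scope ring_scope.
Variable C : preadditive.
Hypothesis abC : is_abelian C.
Implicit Types M P X Z : C.

(** Each of the finitely many maps [P -> M] induces a map from the copower of
    [P] to the copower of [M] over the same index set, and finitely many of
    these are assembled over a disjoint union of index sets. *)
Lemma generator_retract M P (i : hom P M) (p : hom M P) (s : seq (hom P M)) :
  generator M -> p \oc i = idm P ->
  (forall Z (u : hom M Z), (forall t, t \in s -> u \oc t = 0) -> u = 0) ->
  generator P.
Proof.
move=> genM pi epis X; have [I [S [inj [e [copS epe]]]]] := genM X.
pose K (t : hom P M) Z (u : hom S Z) := forall j, u \oc inj j \oc t = 0.
have [//|X1 X2 Y i1 i2 p1 p2 //|t _|J [T [injT [f [copT _ KT]]]]] :=
    @copower_cover_seq _ abC (fun=> True) P S _ K s.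
  have [T [injT copT]] := copower_retract abC pi copS.
  have [f fP] := is_copower_factor (fun j => inj j \oc t) copT.
  exists I, T, injT, f; split=> // Z u uf j.
  by rewrite -hcompA -fP hcompA uf hcomp0l.
exists J, T, injT, (e \oc f); split=> //; apply: epimorphism_comp => //.
apply/epimorphism0P => Z u /KT uK; apply: (is_copower_ext copS) => j.
by rewrite hcomp0l; apply: epis => t /uK.
Qed.

Lemma noetherian_copower_cover (D : C -> Prop) P X :
  (forall Z, is_zero_object Z -> D Z) ->
  (forall X1 X2 Y (i1 : hom X1 Y) (i2 : hom X2 Y) p1 p2,
     is_biproduct i1 i2 p1 p2 -> D X1 -> D X2 -> D Y) ->
  D P -> generator P -> noetherian X ->
  copower_cover D P (fun Z (u : hom X Z) => u = 0).
Proof.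
move=> D0 DD DP genP noeX.
have [|s sP] := noetherian_finite_joint_epi abC (P := P) noeX.
  by move=> Z u; apply: generator_separates.
have [t _|I [T [inj [e [copT DT uT]]]]] := copower_cover_seq abC (P := P)
  (K := fun t Z (u : hom X Z) => u \oc t = 0) (s := s) D0 DD.
  exists unit, P, (fun=> idm P), t; split=> //; exact: is_copower1.
by exists I, T, inj, e; split=> // Z u /uT /sP.
Qed.

(** The cokernel of [f] is a quotient of [Y], so it has finite length and the
    cancellation property of [f] applies to it. *)
Lemma fl_epimorphism (X Y : fl C) (f : hom X Y) :
  epimorphism f -> @epimorphism C (sval X) (sval Y) f.
Proof.
move=> epf; have [Q [q cokq]] := ab_cokernel abC (f : @hom C (sval X) (sval Y)).
have flQ : finite_length Q.
  exact (finite_length_quotient abC (is_cokernel_epi cokq) (svalP Y)).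
have q0 : q = 0.
  apply: (epf (exist _ Q flQ : fl C) q 0).
  by rewrite /= cokq.1 hcomp0l.
apply/epimorphism0P => Z u /(is_cokernel_factor cokq)[w <-].
by rewrite q0 hcomp0r.
Qed.

End Generators.

Theorem theorem2p6 (A : preadditive) (hA : is_abelian A)
    (hsmall : essentially_small A) (M : A) (hgen : generator M)
    (hart : right_artinian (End_ring M)) :
  (exists P : fl A, projective_generator P /\ direct_summand (fl_incl P) M) /\
  (exists P : A, projective_generator P /\ direct_summand P M).
Proof.
have [P [i [p [pi projP epiP]]]] := exists_projective_summand hA hgen hart.
have hflM := hom_finite_length_self hart.
have fl_of := @hom_finite_length_finite_length _ _ hA hgen.
have [s sP] := noetherian_finite_joint_epi hA (fl_of _ hflM).2 epiP.
have genP := generator_retract hA hgen pi sP.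
have sumP := retract_direct_summand hA pi.
split; last by exists P.
have hflP := hom_finite_length_retract pi hflM.
exists (exist _ P (fl_of _ hflP) : fl A); split=> //; split; last first.
  by move=> X Y f /(fl_epimorphism hA); apply: projP.
move=> [X flX].
have [I [T [inj [e [copT hflT epe]]]]] := noetherian_copower_cover hA
  (@hom_finite_length0 A M) (@hom_finite_length_biproduct A M) hflP genP flX.2.
exists I, (exist _ T (fl_of _ hflT)), inj, e; split=> [[W flW] t|[Z flZ] u v].
  exact: copT.
suff epe' : epimorphism e by exact: epe'.
exact/epimorphism0P.
Qed.
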